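(* A natural number $n$ is a CCLT number if and only if either $n$ is a cyclic number, that is, $\gcd(n,\varphi(n))=1$, or $n=pq$, where $p$ and $q$ are prime numbers (not necessarily distinct).
   Context: All groups are finite and natural numbers are positive integers. A finite group $G$ is a CCLT (Cyclic CLT) group if for every proper divisor $d$ of $|G|$ (positive divisor $d\neq |G|$), $G$ contains a cyclic subgroup of order $d$. A natural number $n$ is a CCLT number if every group of order $n$ is a CCLT group. A natural number $n$ is a cyclic number if every group of order $n$ is cyclic; it is known that this is equivalent to $\gcd(n,\varphi(n))=1$, where $\varphi$ is the Euler totient function. *)

(* Defs.v *)
From mathcomp Require Import all_boot all_fingroup all_solvable.

Set Implicit Arguments.
Unset Strict Implicit.
Unset Printing Implicit Defensive.

Definition CCLT_group (gT : finGroupType) (G : {group gT}) : Prop :=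
  forall d : nat, d %| #|G| -> d != #|G| ->
    exists H : {group gT}, [/\ H \subset G, cyclic H & #|H| = d].

(* Both predicates hold vacuously at n = 0, so uses should assume 0 < n. *)
Definition CCLT_number (n : nat) : Prop :=
  forall (gT : finGroupType) (G : {group gT}), #|G| = n -> CCLT_group G.

Definition cyclic_number (n : nat) : Prop :=
  forall (gT : finGroupType) (G : {group gT}), #|G| = n -> cyclic G.

(* Main.v *)
Require Import Defs.
From mathcomp Require Import all_boot all_fingroup all_solvable.
From mathcomp Require Import zmodp.

(** The condition [coprime n (totient n)] says that [n] is squarefree and that
    no prime divisor [p] of [n] divides [q.-1] for another prime divisor [q].

    It forces cyclicity by counting. Suppose that [m * p] divides [#|G|] with
    [p] prime, and that [G] has exactly [m * p] solutions of
    [x ^+ (m * p) = 1]. By Frobenius's theorem [c * m] of them satisfy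
    [x ^+ m = 1], for some [c > 0], and [c < p] by Cauchy's theorem; the other
    [(p - c) * m] have order divisible by [p], and since a cyclic group of such
    an order has a multiple of [p.-1] generators, [p.-1] divides [(p - c) * m],
    hence [p - c], which leaves only [c = 1]. Descending from [m = #|G|], each
    divisor [m] of [#|G|] has exactly [m] solutions ([card_Ldiv]); therefore elements of equal
    order generate the same subgroup, and [G] is cyclic.

    When [n] and [totient n] share a prime, some group of order [n] lacks a
    cyclic subgroup of some order [d] dividing [n]. If [n = p * p * m], take
    [Z_p * Z_p * Z_m], whose exponent divides [lcmn p m], and [d = p * m] or
    [d = p * p] according to whether [p] divides [m]
    ([lacks_cyclic_square]). Otherwise [n = p * q * m] with [p] dividing
    [q.-1] and [m] coprime to [p * q]; take the product of a nonabelian group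
    of order [p * q] with one of order [m], and [d = p * q]
    ([lacks_cyclic_pq]). In all cases [d = n] only if [n] is a product of two
    primes. Such a group is not cyclic, and it refutes the CCLT property unless
    [n] is a product of two primes ([lacks_cyclic_divisor]).

    In the other direction, a cyclic group has a subgroup of each order dividing
    its own, and the proper divisors of [p * q] are [1] and primes, so that
    Cauchy's theorem applies. *)

Set Implicit Arguments.
Unset Strict Implicit.
Unset Printing Implicit Defensive.

Local Open Scope group_scope.

(** * Euler's function and shared prime factors *)

Lemma pred_dvdn_totient n p :
  0 < n -> prime p -> p %| n -> p.-1 %| totient n.
Proof.
move=> n_gt0 pr_p pn.
rewrite totientE // (big_rem p) ?mem_primes ?pr_p ?n_gt0 //=.
by rewrite -mulnA dvdn_mulr.
Qed.

Lemma coprime_totient_squarefree n p :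
  0 < n -> coprime n (totient n) -> prime p -> ~~ (p * p %| n).
Proof.
move=> n_gt0 con pr_p; apply/negP=> ppn.
have pn : p %| n := dvdn_trans (dvdn_mulr p (dvdnn p)) ppn.
have : p %| gcdn n (totient n).
  rewrite dvdn_gcd pn totientE // (big_rem p) ?mem_primes ?pr_p ?n_gt0 //=.
  rewrite dvdn_mulr // dvdn_mull //.
  have : 1 < logn p n by rewrite -pfactor_dvdn // -mulnn.
  by case: (logn p n) => [|[|k]] //= _; rewrite expnS dvdn_mulr.
by rewrite (eqP con) dvdn1 => /eqP p1; rewrite p1 in pr_p.
Qed.

(** The prime [p] shared by [n] and [totient n] divides a factor
    [q.-1 * q ^ (logn q n).-1] of [totient n]: the first term gives [p %| q.-1],
    the second one [p = q] and a square divisor of [n]. *)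
Lemma not_coprime_totient n :
  0 < n -> ~~ coprime n (totient n) ->
  exists p q, [/\ prime p, prime q, p * q %| n & p = q \/ p %| q.-1].
Proof.
move=> n_gt0; rewrite /coprime => ncop.
have gcd_gt1 : 1 < gcdn n (totient n).
  by rewrite ltn_neqAle eq_sym ncop gcdn_gt0 n_gt0.
set p := pdiv (gcdn n (totient n)).
have pr_p : prime p by rewrite pdiv_prime.
have := pdiv_dvd (gcdn n (totient n)); rewrite -/p dvdn_gcd => /andP[pn].
rewrite totientE // Euclid_dvd_prod // big_has => /hasP[q].
rewrite mem_primes n_gt0 /= => /andP[pr_q qn].
rewrite Euclid_dvdM // Euclid_dvdX // => /orP[pq1 | /andP[pq kgt]].
  exists p, q; split; rewrite ?Gauss_dvd ?pn ?qn //; last by right.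
  rewrite prime_coprime // dvdn_prime2 //; apply: contraTneq pq1 => ->.
  by rewrite gtnNdvd ?ltn_predL ?ltn_predRL ?prime_gt0 ?prime_gt1.
have {pq} epq : p = q by apply/eqP; rewrite -dvdn_prime2.
exists p, q; split=> //; last by left.
rewrite epq mulnn pfactor_dvdn //.
by move: kgt; case: (logn q n) => [|[|]].
Qed.

(** * Groups whose order is coprime to its totient *)

Section CyclicNumbers.

Variables (gT : finGroupType) (G : {group gT}).

(** The set is a disjoint union of the sets of generators of cyclic subgroups
    of order [d] with [p %| d], and each of these has [totient d] elements. *)
Lemma dvdn_pred_card_order p m :
  prime p -> p.-1 %| #|[set x in G | (#[x] %| m) && (p %| #[x])]|.
Proof.
move=> pr_p; rewrite -sum1_card (partition_big_imset (@cycle gT)) /=.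
apply: dvdn_sum => _ /imsetP[x + ->]; rewrite inE => /and3P[Gx xm px].
rewrite (eq_bigl (generator <[x]>)) => [|y].
  by rewrite sum1dep_card -totient_gen (pred_dvdn_totient _ pr_p).
rewrite /generator eq_sym andbC; case xy: {+}(_ == _) => //.
by rewrite inE -cycle_subG /order -(eqP xy) cycle_subG Gx xm px.
Qed.

Hypothesis copG : coprime #|G| (totient #|G|).

(** Descent on the cofactor [k] of [m]: if [p] is a prime divisor of [k], the
    count known for [m * p] determines the one for [m]. *)
Lemma card_Ldiv m : m %| #|G| -> #|'Ldiv_m(G)| = m.
Proof.
have LdivE d x : (x \in 'Ldiv_d(G)) = (x \in G) && (#[x] %| d).
  by rewrite !inE order_dvdn.
case/dvdnP=> k; rewrite mulnC; elim/ltn_ind: k m => k IHk m oG.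
have: 0 < m * k by rewrite -oG.
rewrite muln_gt0 => /andP[m_gt0 k_gt0].
have [k1 | k_neq1] := eqVneq k 1%N.
  rewrite -[RHS]muln1 -[in RHS]k1 -oG; apply: eq_card => x.
  rewrite LdivE; case Gx: (x \in G) => //=.
  by rewrite -[m]muln1 -[in X in _ %| X]k1 -oG order_dvdG.
have pr_p : prime (pdiv k) by rewrite pdiv_prime // ltn_neqAle eq_sym k_neq1.
move: (pdiv k) (pdiv_dvd k) pr_p => p /dvdnP[j def_k] pr_p.
have p_gt1 := prime_gt1 pr_p.
have j_gt0 : 0 < j by move: k_gt0; rewrite def_k muln_gt0 => /andP[].
have oGp : #|G| = (m * p * j)%N by rewrite oG def_k -mulnA (mulnC j).
have Lmp : #|'Ldiv_(m * p)(G)| = (m * p)%N.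
  by apply: (IHk j) => //; rewrite def_k ltn_Pmulr.
have pG : p %| #|G| by rewrite oGp -mulnA mulnCA dvdn_mulr.
have p'm : coprime p m.
  rewrite prime_coprime //.
  apply: contra (coprime_totient_squarefree (cardG_gt0 G) copG pr_p) => pm.
  by rewrite oGp dvdn_mulr // dvdn_mul.
(* As [p] does not divide [m], the solutions that are lost when passing from
   [m * p] to [m] are those whose order is divisible by [p]. *)
have splitL : 'Ldiv_(m * p)(G) :\: 'Ldiv_m(G)
    = [set x in G | (#[x] %| m * p) && (p %| #[x])].
  apply/setP=> x; rewrite in_setD !LdivE inE; case: (x \in G) => //=.
  case xmp: (#[x] %| m * p); rewrite ?andbF //= andbT.
  have [px | p'x] := boolP (p %| #[x]).
    apply: contraL p'm => xm; rewrite prime_coprime // negbK.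
    exact: dvdn_trans px xm.
  by rewrite -(@Gauss_dvdl _ _ p) ?xmp // coprime_sym prime_coprime.
have := dvdn_pred_card_order (m * p) pr_p; rewrite -splitL => dvdt.
have := cardsID 'Ldiv_m(G) 'Ldiv_(m * p)(G).
have sL : 'Ldiv_m(G) \subset 'Ldiv_(m * p)(G).
  by apply/subsetP=> x; rewrite !LdivE => /andP[-> /= xm]; rewrite dvdn_mulr.
rewrite (setIidPr sL) Lmp => cardL.
have mG : m %| #|G| by rewrite oG dvdn_mulr.
have /dvdnP[c def_c] := Frobenius_Ldiv mG.
have c_gt0 : 0 < c.
  have: 0 < #|'Ldiv_m(G)|.
    by apply/card_gt0P; exists 1; rewrite LdivE group1 order1 dvd1n.
  by rewrite def_c muln_gt0 => /andP[].
have D_gt0 : 0 < #|'Ldiv_(m * p)(G) :\: 'Ldiv_m(G)|.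
  have [x Gx ox] := Cauchy pr_p pG.
  by apply/card_gt0P; exists x; rewrite splitL inE Gx ox dvdn_mull ?dvdnn.
have lt_cp : c < p.
  rewrite -(ltn_pmul2r m_gt0) -def_c (mulnC p) -cardL.
  by rewrite -[X in X < _]addn0 ltn_add2l.
have dvd_pcm : p.-1 %| (p - c) * m.
  by rewrite mulnBl -def_c (mulnC p) -[X in _ %| X - _]cardL addKn.
have cop1 : coprime p.-1 m.
  rewrite coprime_sym; apply: coprime_dvdl mG _.
  exact: coprime_dvdr (pred_dvdn_totient (cardG_gt0 G) pr_p pG) copG.
have dvd_pc : p.-1 %| p - c by rewrite -(Gauss_dvdl _ cop1).
(* [p - c] is a multiple of [p.-1] strictly between [0] and [p]. *)
have le_p1 : p.-1 <= p - c by rewrite dvdn_leq // subn_gt0.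
rewrite def_c; suff -> : c = 1%N by rewrite mul1n.
apply/eqP; rewrite eqn_leq c_gt0 andbT -(leq_sub2lE _ (ltnW lt_cp)).
by rewrite subn1.
Qed.

(** The [#[z]] elements of [<[z]>] are solutions of [x ^+ #[z] = 1], and there
    are no others: [<[z]>] is determined by the order of [z]. *)
Lemma coprime_totient_cyclic : cyclic G.
Proof.
apply: order_inj_cyclic => x y Gx Gy eq_xy.
have cycE z : z \in G -> <[z]> = 'Ldiv_(#[z])(G).
  move=> Gz; apply/eqP; rewrite eqEcard card_Ldiv ?order_dvdG // leqnn andbT.
  apply/subsetP=> t zt; rewrite !inE -order_dvdn order_dvdG // andbT.
  by move: t zt; apply/subsetP; rewrite cycle_subG.
by rewrite !cycE // eq_xy.
Qed.

End CyclicNumbers.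

(** * Groups lacking a cyclic subgroup of a given order *)

Definition lacks_cyclic_subgroup (n d : nat) : Prop :=
  exists (gT : finGroupType) (G : {group gT}), #|G| = n /\
    forall H : {group gT}, H \subset G -> cyclic H -> #|H| <> d.

Lemma exists_group n :
  0 < n -> exists (gT : finGroupType) (G : {group gT}), #|G| = n.
Proof.
case: n => // n _; exists 'I_n.+1, [set: 'I_n.+1]%G.
by rewrite cardsT card_ord.
Qed.

Lemma setX_exponent (gT rT : finGroupType) (G : {group gT}) (K : {group rT}) :
  exponent (setX G K) = lcmn (exponent G) (exponent K).
Proof.
rewrite -(dprod_exponent (setX_dprod G K)).
congr lcmn; first by rewrite -morphim_pairg1 exponent_injm ?injm_pairg1 ?subsetT.
by rewrite -morphim_pair1g exponent_injm ?injm_pair1g ?subsetT.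
Qed.

Lemma lacks_cyclic_exponent (gT : finGroupType) (G : {group gT}) d :
  ~~ (d %| exponent G) -> lacks_cyclic_subgroup #|G| d.
Proof.
move=> dG; exists gT, G; split=> // H sHG cycH oH.
by case/negP: dG; rewrite -oH -exponent_cyclic // exponentS.
Qed.

(** The group is [P * P * M] with [#|P| = p] and [#|M| = m]. Only an
    upper bound on its exponent matters, so any [M] of that order will do. *)
Lemma lacks_cyclic_square p m :
  prime p -> 0 < m ->
  lacks_cyclic_subgroup (p * p * m) (if p %| m then p * m else p * p)%N.
Proof.
move=> pr_p m_gt0.
have [pT [P oP]] := exists_group (prime_gt0 pr_p).
have [mT [M oM]] := exists_group m_gt0.
have -> : (p * p * m)%N = #|setX (setX P P) M| by rewrite !cardsX oP oM.
apply: (@lacks_cyclic_exponent _ (setX_group (setX_group P P) M)).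
have expE : exponent (setX (setX P P) M) %| lcmn p m.
  have expP : exponent P %| p by rewrite -oP exponent_dvdn.
  have expM : exponent M %| m by rewrite -oM exponent_dvdn.
  rewrite !setX_exponent !dvdn_lcm (dvdn_trans expM) ?dvdn_lcmr //.
  by rewrite (dvdn_trans expP) ?dvdn_lcml.
apply/negP=> /dvdn_trans/(_ expE); case: ifP => pm.
  rewrite (lcmn_idPr pm) => /(dvdn_leq m_gt0).
  by rewrite leqNgt ltn_Pmull ?prime_gt1.
have lcm_pm : lcmn p m %| p * m by rewrite dvdn_lcm dvdn_mulr // dvdn_mull.
by move/dvdn_trans/(_ lcm_pm); rewrite dvdn_pmul2l ?prime_gt0 // pm.
Qed.

(** The automorphism group of a group [Q] of order [q] has order [q.-1], so it
    contains some [a] of order [p]; the semidirect product of [Q] by [<[a]>] is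
    nonabelian because [a] acts nontrivially. *)
Lemma nonabelian_pq p q :
  prime p -> prime q -> p %| q.-1 ->
  exists (gT : finGroupType) (G : {group gT}), #|G| = (p * q)%N /\ ~~ abelian G.
Proof.
move=> pr_p pr_q pq1.
have [qT [Q oQ]] := exists_group (prime_gt0 pr_q).
have pAut : p %| #|Aut Q|.
  by rewrite card_Aut_cyclic ?prime_cyclic ?oQ // totient_prime.
have [a Qa oa] := Cauchy pr_p pAut.
have sA : <[a]> \subset Aut Q by rewrite cycle_subG.
pose to := ([Aut Q] \ sA)%gact.
exists (sdprod_groupType to), [set: sdprod_groupType to]%G; split.
  rewrite -(sdprod_card (sdprod_sdpair to)) mulnC.
  by rewrite !card_injm ?injm_sdpair1 ?injm_sdpair2 // -oQ -oa.
apply/negP=> abG.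
have : a = 1.
  apply: (eq_Aut Qa (group1 _)) => x Qx; rewrite perm1.
  apply: (injmP (injm_sdpair1 to)) => //; first by rewrite Aut_closed.
  have := sdpair_act to Qx (cycle_id a); rewrite /= /aperm => ->.
  by rewrite /conjg (centsP abG (sdpair1 to x) _ (sdpair2 to a)) ?inE // mulKg.
by move=> a1; move: oa pr_p; rewrite a1 order1 => <-.
Qed.

(** In [F * M] with [F] nonabelian of order [p * q] and [#|M| = m], a subgroup
    of order [p * q] projects trivially to [M], whose order is coprime to
    [p * q], and is therefore the noncyclic factor [F]. The exponent does not
    suffice here: that of the symmetric group on three letters is [6]. *)
Lemma lacks_cyclic_pq p q m :
  prime p -> prime q -> p %| q.-1 -> 0 < m -> coprime (p * q) m ->
  lacks_cyclic_subgroup (p * q * m) (p * q).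
Proof.
move=> pr_p pr_q pq1 m_gt0 cop.
have [fT [F [oF nabF]]] := nonabelian_pq pr_p pr_q pq1.
have [mT [M oM]] := exists_group m_gt0.
exists _, (setX F M)%G; split=> [|H sHFM cycH oH]; first by rewrite cardsX oF oM.
have sHF : H \subset setX F 1.
  apply/subsetP=> -[x y] Hxy.
  have /setXP[Fx My] : (x, y) \in setX F M := subsetP sHFM _ Hxy.
  apply/setXP; split=> //=; apply/set1P/eqP; rewrite -order_eq1 -dvdn1.
  rewrite -(eqP cop) dvdn_gcd -oM (order_dvdG My) andbT -oH.
  have := morph_order (snd_morphism fT mT) (in_setT (x, y)).
  by move/dvdn_trans; apply; apply: order_dvdG.
have defH : H :=: setX F 1.
  by apply/eqP; rewrite eqEcard sHF cardsX cards1 muln1 oF oH /=.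
case/negP: nabF; apply/centsP=> x Fx y Fy.
have inH z : z \in F -> (z, 1) \in H by move=> Fz; rewrite defH inE Fz group1.
have := centsP (cyclic_abelian cycH) _ (inH x Fx) _ (inH y Fy).
by case.
Qed.

(** The last clause says when the missing subgroup may be [G] itself, that is,
    when the group witnesses noncyclicity but not the failure of the CCLT
    property. *)
Lemma lacks_cyclic_divisor n :
  0 < n -> ~~ coprime n (totient n) ->
  exists d, [/\ d %| n, lacks_cyclic_subgroup n d &
    d = n -> exists p q, [/\ prime p, prime q & n = (p * q)%N]].
Proof.
move=> n_gt0 /(not_coprime_totient n_gt0)[p [q [pr_p pr_q pqn hpq]]].
set concl := ex _; have square r : prime r -> r * r %| n -> concl.
  move=> pr_r /dvdnP[m]; rewrite mulnC => def_n.
  have m_gt0 : 0 < m by move: n_gt0; rewrite def_n muln_gt0 => /andP[].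
  have := lacks_cyclic_square pr_r m_gt0; rewrite -def_n.
  case: ifP => _ lacks; [exists (r * m)%N | exists (r * r)%N]; split=> //.
  - by rewrite def_n -mulnA dvdn_mull.
  - move=> dn; have := ltn_Pmull (prime_gt1 pr_r) (_ : 0 < r * m).
    by rewrite mulnA -def_n dn ltnn n_gt0 => /(_ isT).
  - by rewrite def_n dvdn_mulr.
  by move=> dn; exists r, r.
case: hpq => [epq | pq1]; first by apply: (square p) => //; rewrite {2}epq.
have [ppn | nppn] := boolP (p * p %| n); first exact: square ppn.
have [qqn | nqqn] := boolP (q * q %| n); first exact: square qqn.
have /dvdnP[m] := pqn; rewrite mulnC => def_n.
have m_gt0 : 0 < m by move: n_gt0; rewrite def_n muln_gt0 => /andP[].
have cop : coprime (p * q) m.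
  rewrite coprimeMl !prime_coprime //; apply/andP; split.
    by apply: contra nppn => pm; rewrite def_n mulnAC dvdn_mulr // dvdn_mul.
  by apply: contra nqqn => qm; rewrite def_n -mulnA dvdn_mull // dvdn_mul.
exists (p * q)%N; split=> //; last by move=> dn; exists p, q.
by rewrite def_n; apply: lacks_cyclic_pq.
Qed.

(** * Cyclic numbers and CCLT numbers *)

Lemma cyclic_subgroup_of_dvd (gT : finGroupType) (G : {group gT}) d :
  cyclic G -> d %| #|G| ->
  exists H : {group gT}, [/\ H \subset G, cyclic H & #|H| = d].
Proof.
case/cyclicP=> x defG dG; rewrite defG in dG.
have := cycle_sub_group dG => /setP/(_ <[x ^+ (#[x] %/ d)]>%G).
rewrite set11 inE defG => /andP[sH /eqP oH].
by exists <[x ^+ (#[x] %/ d)]>%G; rewrite cycle_cyclic.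
Qed.

Lemma proper_dvdn_prime_mul p q d :
  prime p -> prime q -> d %| p * q -> d != (p * q)%N -> (d == 1%N) || prime d.
Proof.
move=> pr_p pr_q dpq; have [/dvdnP[e def_d] | p'd] := boolP (p %| d).
  move: dpq; rewrite def_d mulnC dvdn_pmul2l ?prime_gt0 // => eq.
  case/primeP: pr_q => _ /(_ e eq)/orP[] /eqP->; last by rewrite eqxx.
  by rewrite muln1 pr_p orbT.
rewrite Gauss_dvdr 1?coprime_sym ?prime_coprime // in dpq.
by case/primeP: (pr_q) => _ /(_ d dpq)/orP[] /eqP->; rewrite ?pr_q ?orbT.
Qed.

Lemma prime_mul_CCLT p q : prime p -> prime q -> CCLT_number (p * q).
Proof.
move=> pr_p pr_q gT G oG d; rewrite oG => dpq.
case/(proper_dvdn_prime_mul pr_p pr_q dpq)/orP=> [/eqP-> | pr_d].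
  by exists 1%G; rewrite sub1G cyclic1 cards1.
have [x Gx ox] : {x | x \in G & #[x] = d} by apply: Cauchy; rewrite ?oG.
by exists <[x]>%G; rewrite cycle_subG cycle_cyclic.
Qed.

Lemma cyclic_number_coprime n :
  0 < n -> cyclic_number n <-> coprime n (totient n).
Proof.
move=> n_gt0; split=> [cycn | cop gT G oG]; last first.
  by apply: coprime_totient_cyclic; rewrite oG.
apply: contraT => /(lacks_cyclic_divisor n_gt0)[d [dn [gT [G [oG noH]]] _]].
rewrite -oG in dn.
have [H [sHG cycH oH]] := cyclic_subgroup_of_dvd (cycn _ _ oG) dn.
by case: (noH H).
Qed.

Local Close Scope group_scope.

Theorem theorem1p2 (n : nat) (hn : 0 < n) :
  (CCLT_number n <->
     cyclic_number n \/
     exists p q : nat, [/\ prime p, prime q & n = p * q]) /\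
  (cyclic_number n <-> gcdn n (totient n) = 1).
Proof.
have cycE := cyclic_number_coprime hn.
split; last by split=> [/cycE/eqP | /eqP/cycE].
split=> [CCLTn | [cycn gT G oG d dG _ | [p [q [pr_p pr_q ->]]]]].
- have [/cycE | ncop] := boolP (coprime n (totient n)); first by left.
  have [d [dn [gT [G [oG noH]]] dn_pq]] := lacks_cyclic_divisor hn ncop.
  right; apply: dn_pq; apply/eqP; apply: contraT => d_neq_n.
  rewrite -oG in dn d_neq_n; have [H [sHG cycH oH]] := CCLTn _ _ oG _ dn d_neq_n.
  by case: (noH H).
- exact: cyclic_subgroup_of_dvd (cycn _ _ oG) dG.
exact: prime_mul_CCLT.
Qed.
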